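(* The propositionally quantified modal logic of the class of Euclidean Kripke frames (the set $\mathtt{5}\pi+$ of all formulas of $\mathcal{L}$ valid on every Kripke frame validating $\mathtt{5}=\Diamond p\to\Box\Diamond p$) is exactly $\mathsf{K}_\Pi\mathtt{5}\mathtt{Bc}\mathtt{At}^2\mathtt{R}^2$.
   Context: Language. Fix a countably infinite (enumerated) set $\mathsf{Prop}$ of propositional variables. $\mathcal{L}$ is given by $\varphi::=p\mid\neg\varphi\mid(\varphi\vee\varphi)\mid\Diamond\varphi\mid\exists p\,\varphi$; $\wedge,\to,\leftrightarrow,\Box,\forall p$ are the usual abbreviations; $\mathsf{Fv}(\varphi)$ is the set of free variables. $\Diamond^0\varphi=\varphi$, $\Diamond^{k+1}\varphi=\Diamond\Diamond^k\varphi$, $\Diamond^{\le0}\varphi=\varphi$, $\Diamond^{\le k+1}\varphi=\Diamond^{\le k}\varphi\vee\Diamond^{k+1}\varphi$; $\Box^k,\Box^{\le k}$ are defined dually. Semantics. On a Kripke frame $(W,R)$ ($W\ne\varnothing$, $R\subseteq W^2$), a valuation is $v:\mathsf{Prop}\to\wp(W)$; $[\![p]\!](v)=v(p)$, $\neg,\vee$ are interpreted by complement and union, $[\![\Diamond\varphi]\!](v)=\{w\mid\exists u\in[\![\varphi]\!](v),\ wRu\}$, $[\![\exists p\,\varphi]\!](v)=\bigcup\{[\![\varphi]\!](v[X/p])\mid X\in\wp(W)\}$, where $v[X/p]$ agrees with $v$ except for sending $p$ to $X$. $\varphi$ is valid if $[\![\varphi]\!](v)=W$ for all $v$. The Kripke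 frames validating $\mathtt 5$ are exactly the Euclidean ones ($wRu$ and $wRt$ imply $uRt$). Substitutions. A substitution is $\sigma:\mathsf{Prop}\to\mathcal{L}$; $\sigma_p^\psi$ agrees with $\sigma$ except that it sends $p$ to $\psi$. It extends to $\mathcal{L}$ by commuting with $\neg,\vee,\Diamond$ and $\sigma(\exists p\,\varphi)=\exists q\,\sigma_p^q(\varphi)$, where $q=p$ if $p\notin\bigcup_{r\in\mathsf{Fv}(\exists p\varphi)}\mathsf{Fv}(\sigma(r))$ and otherwise $q$ is the first variable not used in $\exists p\,\varphi$ nor in any $\sigma(r)$, $r\in\mathsf{Fv}(\exists p\,\varphi)$. $\iota$ is the identity substitution. Logics. A normal propositionally quantified modal logic (NPQML) is a set $\Lambda\subseteq\mathcal{L}$ such that: all propositional tautologies are in $\Lambda$; $\Box(p\to q)\to(\Box p\to\Box q)$ and $\Diamond p\leftrightarrow\neg\Box\neg p$ are in $\Lambda$; all instances of $\iota_p^\psi(\varphi)\to\exists p\,\varphi$ are in $\Lambda$; $\varphi\in\Lambda$ implies $\Box\varphi\in\Lambda$; $\varphi,\varphi\to\psi\in\Lambda$ imply $\psi\in\Lambda$; if $\varphi\to\psi\in\Lambda$ and $p\notin\mathsf{Fv}(\psi)$ then $\exists p\,\varphi\to\psi\in\Lambda$. $\mathsf{K}_\Pi A_1\dots A_k$ is the smallest NPQML containing all (instances of) $A_1,\dots,A_k$. Axioms. $\mathtt{Bc}$ is the Barcan scheme $\Diamond\exists p\,\varphi\to\exists p\,\Diamond\varphi$. $\mathtt{Q}^n(\varphi)=\Diamond^{\le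 n}\varphi\wedge\forall p(\Box^{\le n}(\varphi\to p)\vee\Box^{\le n}(\varphi\to\neg p))$ with $p$ the first variable not in $\mathsf{Fv}(\varphi)$. $\mathtt{At}^n=\forall q(\Diamond^{\le n}q\to\exists p(\mathtt{Q}^n(p)\wedge\Box^{\le n}(p\to q)))$. $\mathtt{R}^n=\forall p\exists q(\Box^{\le n}(p\to\Box q)\wedge\forall r(\Box^{\le n}(p\to\Box r)\to\Box^{\le n}(q\to r)))$. *)

(* Defs.v *)
From mathcomp Require Import all_boot.
From mathcomp Require Import boolp classical_sets.

Set Implicit Arguments.
Unset Strict Implicit.
Unset Printing Implicit Defensive.

Local Open Scope classical_set_scope.

(* Propositional variables are natural numbers, enumerated in their usual     *)
(* order.                                                                     *)
Inductive form : Type :=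
| Var of nat
| Neg of form
| Or of form & form
| Dia of form
| Ex of nat & form.

Definition And (a b : form) : form := Neg (Or (Neg a) (Neg b)).
Definition Imp (a b : form) : form := Or (Neg a) b.
Definition Iff (a b : form) : form := And (Imp a b) (Imp b a).
Definition Box (a : form) : form := Neg (Dia (Neg a)).
Definition All (p : nat) (a : form) : form := Neg (Ex p (Neg a)).

Definition dia_iter (k : nat) (a : form) : form := iter k Dia a.
Definition box_iter (k : nat) (a : form) : form := iter k Box a.

Fixpoint dia_le (k : nat) (a : form) : form :=
  if k is j.+1 then Or (dia_le j a) (dia_iter j.+1 a) else a.

Fixpoint box_le (k : nat) (a : form) : form :=
  if k is j.+1 then And (box_le j a) (box_iter j.+1 a) else a.

Fixpoint free_vars (a : form) : seq nat :=
  match a with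
  | Var p => [:: p]
  | Neg b => free_vars b
  | Or b c => free_vars b ++ free_vars c
  | Dia b => free_vars b
  | Ex p b => [seq r <- free_vars b | r != p]
  end.

(* All variables used in a formula: free, bound, or vacuously quantified.     *)
Fixpoint used_vars (a : form) : seq nat :=
  match a with
  | Var p => [:: p]
  | Neg b => used_vars b
  | Or b c => used_vars b ++ used_vars c
  | Dia b => used_vars b
  | Ex p b => p :: used_vars b
  end.

(* The first variable not in s. By the pigeonhole principle, the search may   *)
(* be limited to 0, ..., size s; see fresh_notin and fresh_min.               *)
Definition fresh (s : seq nat) : nat :=
  find (fun p => p \notin s) (iota 0 (size s).+1).

Lemma has_fresh (s : seq nat) :
  has (fun p => p \notin s) (iota 0 (size s).+1).
Proof.
apply/negPn/negP => /hasPn h.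
have /uniq_leq_size : {subset iota 0 (size s).+1 <= s}.
  by move=> p /h; rewrite negbK.
by move=> /(_ (iota_uniq _ _)); rewrite size_iota ltnn.
Qed.

Lemma fresh_notin (s : seq nat) : fresh s \notin s.
Proof.
have := nth_find 0 (has_fresh s); rewrite nth_iota //.
by have := has_fresh s; rewrite has_find size_iota.
Qed.

Lemma fresh_min (s : seq nat) (p : nat) : p < fresh s -> p \in s.
Proof.
move=> lt_p; have := before_find 0 lt_p; rewrite nth_iota.
  by move/negbFE.
by apply: ltn_trans lt_p _; have := has_fresh s; rewrite has_find size_iota.
Qed.

Fixpoint subst (s : nat -> form) (a : form) : form :=
  match a with
  | Var p => s p
  | Neg b => Neg (subst s b)
  | Or b c => Or (subst s b) (subst s c)
  | Dia b => Dia (subst s b)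
  | Ex p b =>
      let fv := free_vars (Ex p b) in
      let q :=
        if p \notin flatten [seq free_vars (s r) | r <- fv] then p
        else fresh (used_vars (Ex p b) ++
                    flatten [seq used_vars (s r) | r <- fv]) in
      Ex q (subst [eta s with p |-> Var q] b)
  end.

Record frame : Type := Frame {
  world : Type;
  acc : world -> world -> Prop;
  world_inhabited : inhabited world
}.

Fixpoint eval (F : frame) (v : nat -> set (world F)) (a : form) :
    set (world F) :=
  match a with
  | Var p => v p
  | Neg b => ~` eval v b
  | Or b c => eval v b `|` eval v c
  | Dia b => [set w | exists u, eval v b u /\ acc w u]
  | Ex p b => \bigcup_(X in [set: set (world F)]) eval [eta v with p |-> X] b
  end.

Definition valid (F : frame) (a : form) : Prop :=
  forall v : nat -> set (world F), eval v a = [set: world F].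

(* Truth-functional evaluation: variables and formulas whose main connective  *)
(* is Dia or Ex count as atoms.                                               *)
Fixpoint bool_eval (e : form -> bool) (a : form) : bool :=
  match a with
  | Neg b => ~~ bool_eval e b
  | Or b c => bool_eval e b || bool_eval e c
  | _ => e a
  end.

Definition tautology (a : form) : Prop :=
  forall e : form -> bool, bool_eval e a.

(* The pairwise distinct variables p, q, r in which the axioms are written    *)
(* are 0, 1 and 2.                                                            *)
Record npqml (L : set form) : Prop := Npqml {
  npqml_taut : forall a, tautology a -> L a;
  npqml_K : L (Imp (Box (Imp (Var 0) (Var 1)))
                   (Imp (Box (Var 0)) (Box (Var 1))));
  npqml_dual : L (Iff (Dia (Var 0)) (Neg (Box (Neg (Var 0)))));
  npqml_inst : forall p a b, L (Imp (subst [eta Var with p |-> b] a) (Ex p a));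
  npqml_nec : forall a, L a -> L (Box a);
  npqml_mp : forall a b, L a -> L (Imp a b) -> L b;
  npqml_ex : forall p a b,
    L (Imp a b) -> p \notin free_vars b -> L (Imp (Ex p a) b)
}.

(* The smallest normal propositionally quantified modal logic containing all  *)
(* substitution instances of the formulas in A.                               *)
Definition K_Pi (A : set form) : set form :=
  [set a | forall L : set form,
     npqml L -> (forall (s : nat -> form) b, A b -> L (subst s b)) -> L a].

Definition ax5 : form := Imp (Dia (Var 0)) (Box (Dia (Var 0))).

Definition axBc : set form :=
  [set a | exists p b, a = Imp (Dia (Ex p b)) (Ex p (Dia b))].

Definition Q (n : nat) (a : form) : form :=
  let p := fresh (free_vars a) in
  And (dia_le n a)
      (All p (Or (box_le n (Imp a (Var p))) (box_le n (Imp a (Neg (Var p)))))).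

Definition axAt (n : nat) : form :=
  All 1 (Imp (dia_le n (Var 1))
             (Ex 0 (And (Q n (Var 0)) (box_le n (Imp (Var 0) (Var 1)))))).

Definition axR (n : nat) : form :=
  All 0 (Ex 1 (And (box_le n (Imp (Var 0) (Box (Var 1))))
                   (All 2 (Imp (box_le n (Imp (Var 0) (Box (Var 2))))
                               (box_le n (Imp (Var 1) (Var 2))))))).

Definition logic_5pi : set form :=
  [set a | forall F : frame, valid F ax5 -> valid F a].

(* Main.v *)
(* Completeness goes through a canonical general frame: its worlds are the    *)
(* witnessed maximal consistent sets, its propositions the extensions of      *)
(* formulas; the Barcan axiom provides witnessed successors.  In the part     *)
(* generated by a world [u], [At^2] makes the worlds whose singleton is a     *)
(* proposition dense, and [R^2] keeps the images of propositions under        *)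
(* accessibility propositions, up to such isolated worlds.  Discarding the    *)
(* other worlds therefore preserves truth.  A generated Euclidean frame is a  *)
(* root [u] together with a universal cluster, so that accessibility is       *)
(* determined by three propositions.  A formula only sees the sizes, up to a  *)
(* finite threshold, of the cells cut out by these and by its parameters;     *)
(* hence an arbitrary set of isolated worlds can be replaced by a proposition *)
(* which is finite or cofinite in every cell, and letting the quantifiers     *)
(* range over all sets of isolated worlds does not change truth either.       *)

Require Import Defs.
From mathcomp Require Import all_boot.
From mathcomp Require Import boolp classical_sets.

Set Implicit Arguments.
Unset Strict Implicit.
Unset Printing Implicit Defensive.

Local Open Scope classical_set_scope.

(** * Substitution *)

(** Soundness is a check on Euclidean frames: singletons witness [axAt 2], images under
    accessibility witness [axR 2]. For completeness, the negation of a non-theorem holds at a world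
    of the canonical general frame ([lindenbaum], [truth]), where quantifiers range over definable
    sets only. The difficulty is to reach a Kripke frame, where they range over all sets.

    Exponent 2 is enough because two steps exhaust the part generated by a world of a Euclidean
    frame. There [axAt 2] puts an isolated world into each proposition that meets this part
    ([isolated_dense]), and [axR 2] gives every diamond true at an isolated world an isolated
    witness ([isolated_succ]). The traces of the propositions on the isolated worlds form a field of
    sets containing the singletons and the sets that determine accessibility ([traces_zone]). An
    Ehrenfeucht-Fraisse argument with set moves applies: a formula compares cell sizes only up to a
    finite threshold, so any set can be exchanged for one that is finite or cofinite in each cell
    ([split_count], [similar_geval]), and such sets belong to the field ([approximate]). By
    induction on formulas, [geval_points] drops the other worlds and widens the quantifiers in one
    go. *)

Definition subst1 (p : nat) (b : form) : form -> form :=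
  subst [eta Var with p |-> b].

Definition bound_var (s : nat -> form) (p : nat) (b : form) : nat :=
  let fv := free_vars (Ex p b) in
  if p \notin flatten [seq free_vars (s r) | r <- fv] then p
  else fresh (used_vars (Ex p b) ++ flatten [seq used_vars (s r) | r <- fv]).

Lemma subst_Ex s p b :
  subst s (Ex p b) =
  Ex (bound_var s p b) (subst [eta s with p |-> Var (bound_var s p b)] b).
Proof. by []. Qed.

Lemma free_vars_used r a : r \in free_vars a -> r \in used_vars a.
Proof.
elim: a r => [q|b IH|b IHb c IHc|b IH|q b IH] r //=.
- exact: IH.
- by rewrite !mem_cat => /orP[/IHb|/IHc] ->; rewrite ?orbT.
- exact: IH.
- by rewrite mem_filter inE => /andP[_ /IH ->]; rewrite orbT.
Qed.

Lemma mem_flatten_map (f : nat -> seq nat) (l : seq nat) r x :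
  r \in l -> x \in f r -> x \in flatten [seq f i | i <- l].
Proof. by move=> rl xr; apply/flatten_mapP; exists r. Qed.

Lemma free_vars_Ex r p b :
  (r \in free_vars (Ex p b)) = (r != p) && (r \in free_vars b).
Proof. by rewrite /= mem_filter. Qed.

Lemma bound_var_notin s p b r : r \in free_vars b -> r != p ->
  bound_var s p b \notin free_vars (s r).
Proof.
move=> rb rp; have rfv : r \in free_vars (Ex p b) by rewrite free_vars_Ex rp.
rewrite /bound_var; case: ifPn => [pN|_].
  by apply: contra pN => /(mem_flatten_map (f := fun r => _) rfv).
set l := _ ++ _; have := fresh_notin l.
rewrite mem_cat negb_or => /andP[_]; apply: contra => /free_vars_used.
exact: (mem_flatten_map (f := fun r => _) rfv).
Qed.

Lemma eq_subst s t a : {in free_vars a, s =1 t} -> subst s a = subst t a.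
Proof.
elim: a s t => [q|b IH|b IHb c IHc|b IH|p b IH] s t st.
- by rewrite /= st // inE.
- by rewrite /= (IH s t).
- by rewrite /= (IHb s t) ?(IHc s t) // => r rb; apply: st;
    rewrite /= mem_cat rb ?orbT.
- by rewrite /= (IH s t).
(* Rewriting with this conditional equation leaves a trivial goal and its premise, that both
   substitutions choose the same bound variable. *)
have -> : bound_var s p b = bound_var t p b -> subst s (Ex p b) = subst t (Ex p b).
  move=> eb; rewrite !subst_Ex eb; congr Ex; apply: IH => r rb /=.
  by case: eqVneq => // rp; apply: st; rewrite free_vars_Ex rp.
- by [].
rewrite /bound_var; have e (f : form -> seq nat) :
    [seq f (s r) | r <- free_vars (Ex p b)] =
    [seq f (t r) | r <- free_vars (Ex p b)].
  by apply/eq_in_map => r rb; rewrite st.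
by rewrite !e.
Qed.

Lemma subst_id s a : {in free_vars a, s =1 Var} -> subst s a = a.
Proof.
move=> sV; rewrite (eq_subst sV) {sV}.
elim: a => [q|b IH|b IHb c IHc|b IH|p b IH] //=; rewrite ?IH ?IHb ?IHc //.
have -> : flatten [seq free_vars (Var r) | r <- [seq r <- free_vars b | r != p]]
   = free_vars (Ex p b) by rewrite /=; elim: [seq _ <- _ | _] => //= x l ->.
rewrite free_vars_Ex eqxx /=; congr Ex; rewrite -[RHS]IH; apply: eq_subst => r _ /=.
by case: eqVneq => [->|].
Qed.

Lemma subst1_id p b a : p \notin free_vars a -> subst1 p b a = a.
Proof.
move=> pa; apply: subst_id => r ra /=.
by case: eqVneq => // rp; rewrite -rp ra in pa.
Qed.

Lemma free_vars_subst s a x :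
  x \in free_vars (subst s a) ->
  exists2 r, r \in free_vars a & x \in free_vars (s r).
Proof.
elim: a s => [q|b IH|b IHb c IHc|b IH|p b IH] s.
- by move=> xq; exists q; rewrite //= inE.
- exact: IH.
- rewrite /= mem_cat => /orP[/IHb|/IHc] [r ra xr]; exists r => //;
    by rewrite mem_cat ra ?orbT.
- exact: IH.
rewrite subst_Ex free_vars_Ex => /andP[xq /IH [r rb]] /=.
case: eqVneq => [_|rp xr]; first by rewrite inE (negbTE xq).
by exists r; rewrite // -/(free_vars (Ex p b)) free_vars_Ex rp.
Qed.

(** * General frames *)

(** With [B] full this is [eval] ([eval_geval]). Closure of [B] under the connectives is assumed
    only later, as [B_geval]. *)
Fixpoint geval (T : Type) (R : T -> T -> Prop) (B : set (set T))
    (v : nat -> set T) (a : form) : set T :=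
  match a with
  | Var p => v p
  | Neg b => [set x | ~ geval R B v b x]
  | Or b c => [set x | geval R B v b x \/ geval R B v c x]
  | Dia b => [set x | exists2 y, R x y & geval R B v b y]
  | Ex p b => [set x | exists2 X, B X & geval R B [eta v with p |-> X] b x]
  end.

Lemma eval_geval (F : frame) v a : eval v a = geval (@acc F) setT v a.
Proof.
elim: a v => [p|b IH|b IHb c IHc|b IH|p b IH] v /=; apply/seteqP; split=> x /=;
  rewrite ?IH ?IHb ?IHc //.
- by case=> y []; exists y.
- by case=> y; exists y.
- by case=> X BX; rewrite IH; exists X.
- by case=> X BX h; exists X; rewrite // IH.
Qed.

Section GeneralFrame.
Variables (T : Type) (R : T -> T -> Prop) (B : set (set T)).
Local Notation ev := (geval R B).

Lemma eq_geval v v' a : {in free_vars a, v =1 v'} -> ev v a = ev v' a.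
Proof.
elim: a v v' => [p|b IH|b IHb c IHc|b IH|p b IH] v v' vv' /=.
- by rewrite vv' // inE.
- by rewrite (IH v v').
- by rewrite (IHb v v') ?(IHc v v') // => r rb; apply: vv';
    rewrite /= mem_cat rb ?orbT.
- by rewrite (IH v v').
apply/funext => x; apply/propext.
have e X : ev [eta v with p |-> X] b = ev [eta v' with p |-> X] b.
  apply: IH => r rb /=; case: eqVneq => // rp.
  by apply: vv'; rewrite free_vars_Ex rp.
by split=> -[X BX h]; exists X => //; move: h; rewrite e.
Qed.

Lemma geval_Or v a b x : ev v (Or a b) x = (ev v a x \/ ev v b x).
Proof. by []. Qed.

Lemma geval_Ex v p a x :
  ev v (Ex p a) x = exists2 X, B X & ev [eta v with p |-> X] a x.
Proof. by []. Qed.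

Lemma geval_Imp v a b x : ev v (Imp a b) x = (ev v a x -> ev v b x).
Proof. by apply/propext; rewrite /= implyE. Qed.

Lemma geval_And v a b x : ev v (And a b) x = (ev v a x /\ ev v b x).
Proof. by rewrite /= not_orE !notE. Qed.

Lemma geval_Box v a x : ev v (Box a) x = (forall y, R x y -> ev v a y).
Proof.
apply/propext => /=; split=> [h y xy|h [y xy]]; last by case; apply: h.
by apply: contrapT => nay; apply: h; exists y.
Qed.

Lemma geval_All v p a x :
  ev v (All p a) x = (forall X, B X -> ev [eta v with p |-> X] a x).
Proof.
apply/propext => /=; split=> [h X BX|h [X BX]]; last by case; apply: h.
by apply: contrapT => nay; apply: h; exists X.
Qed.

(** The accessibility behind the modalities of exponent at most 2; on Euclidean frames it is
    transitive ([near_trans]). *)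
Definition near (x y : T) : Prop :=
  [\/ x = y, R x y | exists2 z, R x z & R z y].

Lemma geval_box_le2 v a x :
  ev v (box_le 2 a) x = (forall y, near x y -> ev v a y).
Proof.
have -> : box_le 2 a = And (And a (Box a)) (Box (Box a)) by [].
rewrite !geval_And !geval_Box.
apply/propext; split=> [[[h0 h1] h2] y [<-//|/h1//|[z xz zy]]|h].
  by have := h2 z xz; rewrite geval_Box; apply.
split; first split; first by apply: h; apply: Or31.
  by move=> y xy; apply: h; apply: Or32.
move=> z xz; rewrite geval_Box => y zy; apply: h; apply: Or33; by exists z.
Qed.

Lemma geval_dia_le2 v a x :
  ev v (dia_le 2 a) x = (exists2 y, near x y & ev v a y).
Proof.
apply/propext => /=; split.
  move=> [[h|[y xy h]]|[y xy [z yz h]]].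
  - by exists x => //; apply: Or31.
  - by exists y => //; apply: Or32.
  - by exists z => //; apply: Or33; exists y.
move=> [y [<-|xy|[z xz zy]] h]; first by left; left.
  by left; right; exists y.
by right; exists z => //; exists y.
Qed.

(** Relative to the worlds near [x], the set [X] is an atom of [B] below [Y]. *)
Lemma geval_At v x :
  ev v (axAt 2) x =
  (forall Y, B Y -> (exists2 y, near x y & Y y) ->
   exists2 X, B X &
     [/\ exists2 y, near x y & X y,
         forall Z, B Z -> (forall y, near x y -> X y -> Z y) \/
                          (forall y, near x y -> X y -> ~ Z y) &
         forall y, near x y -> X y -> Y y]).
Proof.
rewrite /axAt geval_All; apply: eq_forall => Y; apply: eq_forall => BY.
rewrite geval_Imp geval_dia_le2 -(_ : ev [eta v with 1 |-> Y] (Var 1) = Y) //.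
apply: eq_forall => hY; apply/propext.
have E X : ev [eta [eta v with 1 |-> Y] with 0 |-> X]
    (And (Q 2 (Var 0)) (box_le 2 (Imp (Var 0) (Var 1)))) x =
    [/\ exists2 y, near x y & X y,
         forall Z, B Z -> (forall y, near x y -> X y -> Z y) \/
                          (forall y, near x y -> X y -> ~ Z y) &
         forall y, near x y -> X y -> Y y].
  rewrite geval_And /Q geval_And geval_dia_le2 geval_All geval_box_le2.
  (* [Q] quantifies over variable 1, which hides the value [Y] inside [Q] only. *)
  have -> : fresh (free_vars (Var 0)) = 1 by [].
  apply/propext; split=> [[[hX h] h']|[hX h h']].
    split=> //; last by move=> y /h'; rewrite geval_Imp.
    move=> Z /h; rewrite geval_Or !geval_box_le2 => -[] hZ; [left|right] => y xy;
      by have := hZ y xy; rewrite geval_Imp.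
  split; first split=> //.
    move=> Z /h; rewrite geval_Or !geval_box_le2 => -[] hZ; [left|right] => y xy;
      by rewrite geval_Imp; apply: hZ.
  by move=> y xy; rewrite geval_Imp; apply: h'.
by rewrite geval_Ex; split=> -[X BX h]; exists X => //; move: h; rewrite E.
Qed.

(** Relative to the worlds near [x], the set [Y] is the least member of [B] containing the image of
    [X]. *)
Lemma geval_R v x :
  ev v (axR 2) x =
  (forall X, B X -> exists2 Y, B Y &
     (forall y z, near x y -> X y -> R y z -> Y z) /\
     forall Z, B Z -> (forall y z, near x y -> X y -> R y z -> Z z) ->
       forall y, near x y -> Y y -> Z y).
Proof.
have E v' p q : ev v' (box_le 2 (Imp (Var p) (Box (Var q)))) x =
    (forall y z, near x y -> v' p y -> R y z -> v' q z).
  rewrite geval_box_le2; apply/propext; split=> [h y z xy|h y xy].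
    by have := h y xy; rewrite geval_Imp geval_Box => {}h Xy; apply: h.
  by rewrite geval_Imp geval_Box => Xy z; apply: h.
rewrite /axR geval_All; apply: eq_forall => X; apply: eq_forall => BX.
rewrite geval_Ex; apply/propext; split=> -[Y BY h]; exists Y => //; move: h;
  rewrite geval_And E geval_All => -[h1 h2]; split=> // Z BZ.
  move=> hZ; have := h2 Z BZ; rewrite geval_Imp E geval_box_le2 => /(_ hZ) h y.
  by move=> /h; rewrite geval_Imp.
rewrite geval_Imp E => hZ; rewrite geval_box_le2 => y xy; rewrite geval_Imp.
exact: h2.
Qed.

End GeneralFrame.

Lemma eval_subst (F : frame) v s a :
  @eval F v (subst s a) = eval (fun r => eval v (s r)) a.
Proof.
elim: a v s => [p|b IH|b IHb c IHc|b IH|p b IH] v s;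
  rewrite ?subst_Ex /= ?IH ?IHb ?IHc //.
apply: eq_bigcupr => X _; rewrite IH !eval_geval; apply: eq_geval => r rb /=.
case: eqVneq => [_ | rp] /=; first by rewrite eqxx.
rewrite !eval_geval; apply: eq_geval => u ur /=; case: eqVneq => // uq.
by have := bound_var_notin s rb rp; rewrite -uq ur.
Qed.

Lemma valid_subst F s a : valid F a -> valid F (subst s a).
Proof. by move=> h v; rewrite eval_subst h. Qed.

(** * Soundness *)

Lemma eval_bool F (v : nat -> set (world F)) x a :
  bool_eval (fun b => `[< eval v b x >]) a = `[< eval v a x >].
Proof.
elim: a => //= [b ->|b -> c ->]; first by rewrite -asbool_neg.
by rewrite -asbool_or.
Qed.

Lemma valid_at F a : valid F a <-> forall v x, @eval F v a x.
Proof.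
split=> [h v x|h v]; first by rewrite h.
by apply/seteqP; split=> x _ //; apply: h.
Qed.

Lemma eval_Imp F v a b x : @eval F v (Imp a b) x = (eval v a x -> eval v b x).
Proof. by rewrite !eval_geval geval_Imp. Qed.

Lemma npqml_logic_5pi : npqml logic_5pi.
Proof.
split.
- move=> a ta F _; apply/valid_at => v x.
  by apply/asboolP; rewrite -eval_bool; apply: ta.
- move=> F _; apply/valid_at => v x.
  rewrite eval_geval 2!geval_Imp !geval_Box => h1 h2 y xy.
  by have := h1 y xy; rewrite geval_Imp; apply; apply: h2.
- move=> F _; apply/valid_at => v x; rewrite eval_geval geval_And !geval_Imp.
  have E c : geval (@acc F) setT v (Neg (Neg c)) = geval (@acc F) setT v c.
    by apply/seteqP; split=> y /=; rewrite notE.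
  by rewrite /Box E; split=> -[y xy h]; exists y => //; apply: contrapT h.
- move=> p a b F _; apply/valid_at => v x; rewrite eval_Imp eval_subst => h.
  exists (eval v b) => //=; move: h; rewrite !eval_geval.
  rewrite (@eq_geval _ _ _ _ [eta v with p |-> geval (@acc F) setT v b] a) //.
  by move=> r _ /=; case: eqVneq => _; rewrite ?eval_geval.
- move=> a h F hF; apply/valid_at => v x; rewrite eval_geval geval_Box => y _.
  by rewrite -eval_geval (h F hF).
- move=> a b ha hab F hF; apply/valid_at => v x.
  have := proj1 (valid_at F _) (hab F hF) v x; rewrite eval_Imp; apply.
  by rewrite (ha F hF).
- move=> p a b h pb F hF; apply/valid_at => v x; rewrite eval_Imp => -[X _].
  have := proj1 (valid_at F _) (h F hF) [eta v with p |-> X] x.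
  rewrite eval_Imp => /[apply]; rewrite !eval_geval (@eq_geval _ _ _ _ v b) //.
  by move=> r rb /=; case: eqVneq => // rp; rewrite -rp rb in pb.
Qed.

Definition euclidean (T : Type) (R : T -> T -> Prop) :=
  forall x y z, R x y -> R x z -> R y z.

Lemma valid_ax5 F : valid F ax5 <-> euclidean (@acc F).
Proof.
split=> [/valid_at h x y z xy xz|h].
  have := h (fun _ => [set z]) x.
  rewrite eval_geval geval_Imp geval_Box => /(_ _ y xy) [|_ yz /= <- //].
  by exists z.
apply/valid_at => v x; rewrite eval_geval geval_Imp geval_Box.
by move=> [z xz vz] y xy; exists z; rewrite //; apply: h xz.
Qed.

Lemma valid_Bc F a : axBc a -> valid F a.
Proof.
move=> [p [b ->]]; apply/valid_at => v x; rewrite eval_Imp.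
by move=> [y [[X _ h] xy]]; exists X => //; exists y.
Qed.

Lemma valid_At F : valid F (axAt 2).
Proof.
apply/valid_at => v x; rewrite eval_geval geval_At => Y _ [y xy Yy].
exists [set y] => //; split; [by exists y| |by move=> z _ ->].
move=> Z _; have [Zy|nZy] := pselect (Z y); [left|right]; by move=> z _ ->.
Qed.

Lemma valid_R F : valid F (axR 2).
Proof.
apply/valid_at => v x; rewrite eval_geval geval_R => X _.
exists [set z | exists y, [/\ near (@acc F) x y, X y & acc y z]] => //.
by split=> [y z xy Xy yz|Z _ h z _ [y [xy Xy yz]]]; [exists y|apply: h yz].
Qed.

Lemma soundness :
  K_Pi ([set ax5] `|` axBc `|` [set axAt 2] `|` [set axR 2]) `<=` logic_5pi.
Proof.
move=> a; apply; first exact: npqml_logic_5pi.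
move=> s b hb F hF; apply: valid_subst.
case: hb => [[[->|/valid_Bc]|->]|->] //; [exact: valid_At|exact: valid_R].
Qed.

Lemma mem_free_vars_subst s a r x :
  r \in free_vars a -> x \in free_vars (s r) -> x \in free_vars (subst s a).
Proof.
elim: a s => [q|b IH|b IHb c IHc|b IH|p b IH] s.
- by rewrite inE => /eqP ->.
- exact: IH.
- by rewrite /= !mem_cat => /orP[/IHb|/IHc] h /h ->; rewrite ?orbT.
- exact: IH.
rewrite free_vars_Ex => /andP[rp rb] xr; rewrite subst_Ex free_vars_Ex.
rewrite (IH _ rb) /= ?(negbTE rp) // andbT.
by apply: contraNneq (bound_var_notin s rb rp) => <-.
Qed.

(** * Derivations *)

(** The first pattern splits on subformulas left abstract, the second on formulas that [bool_eval]
    takes as atoms. *)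
Ltac truth_table :=
  move=> /= ?;
  repeat match goal with
  | |- context [bool_eval ?e ?a] => case: (bool_eval e a)
  | |- context [?f ?a] => lazymatch type of f with form -> bool => case: (f a) end
  end; done.

Section Logic.
Variables (L : set form) (hL : npqml L).

Lemma taut1 a b :
  L a -> (forall e, bool_eval e a -> bool_eval e b) -> L b.
Proof.
move=> La ab; apply: (npqml_mp hL La); apply: (npqml_taut hL) => e /=.
by rewrite -implybE; apply/implyP/ab.
Qed.

Lemma taut2 a b c : L a -> L b ->
  (forall e, bool_eval e a -> bool_eval e b -> bool_eval e c) -> L c.
Proof.
move=> La Lb abc; apply: (npqml_mp hL Lb); apply: (taut1 La) => e ea /=.
by rewrite -implybE; apply/implyP/abc.
Qed.

Lemma taut3 a b c d : L a -> L b -> L c ->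
  (forall e, bool_eval e a -> bool_eval e b -> bool_eval e c ->
   bool_eval e d) -> L d.
Proof.
move=> La Lb Lc abcd; apply: (npqml_mp hL Lc); apply: (taut2 La Lb) => e ea eb.
by rewrite /= -implybE; apply/implyP/abcd.
Qed.

Lemma Imp_trans a b c : L (Imp a b) -> L (Imp b c) -> L (Imp a c).
Proof. by move=> ab bc; apply: (taut2 ab bc); truth_table. Qed.

Lemma Imp_refl a : L (Imp a a).
Proof. by apply: (npqml_taut hL); truth_table. Qed.

(** Substitution is not a rule of an [npqml] but follows from those for [Ex]: if [a] is a theorem
    then [Ex p (Neg a)] is refutable, hence so is every instance of [Neg a]. *)
Lemma L_subst1 p b a : L a -> L (subst1 p b a).
Proof.
move=> La; pose f := Neg (Imp (Var p.+1) (Var p.+1)).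
have h : L (Imp (Ex p (Neg a)) f).
  apply: (npqml_ex hL); first by apply: (taut1 La); truth_table.
  by rewrite /= !inE (ltn_eqF (ltnSn p)).
by apply: (taut2 h (npqml_inst hL p (Neg a) b)); rewrite -/(subst1 p b _);
  truth_table.
Qed.

Lemma axiom_K a b : L (Imp (Box (Imp a b)) (Imp (Box a) (Box b))).
Proof.
(* Three single substitutions simulate a simultaneous one: variable 0 is parked at [m], so that
   putting [b] for 1 does not act inside [a]. *)
pose m := fresh [:: 0, 1 & free_vars b].
have := fresh_notin [:: 0, 1 & free_vars b].
rewrite -/m !inE !negb_or => /and3P[m0 m1 mb].
have := L_subst1 m a (L_subst1 1 b (L_subst1 0 (Var m) (npqml_K hL))).
rewrite /subst1 /= eqxx -/(subst1 m a b) subst1_id //.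
Qed.

Lemma axiom_dual a : L (Iff (Dia a) (Neg (Box (Neg a)))).
Proof. exact: (L_subst1 0 a (npqml_dual hL)). Qed.

Lemma Dia_mono a b : L (Imp a b) -> L (Imp (Dia a) (Dia b)).
Proof.
move=> ab; have h : L (Box (Imp (Neg b) (Neg a))).
  by apply: (npqml_nec hL); apply: (taut1 ab); truth_table.
have h' := npqml_mp hL h (axiom_K _ _).
by apply: (taut3 h' (axiom_dual a) (axiom_dual b)); truth_table.
Qed.

Lemma Dia_Or a b : L (Imp (Dia (Or a b)) (Or (Dia a) (Dia b))).
Proof.
have h1 : L (Imp (Dia (Neg (Imp (Neg a) (Neg (Or a b))))) (Dia b)).
  by apply: Dia_mono; apply: (npqml_taut hL); truth_table.
have := taut2 (axiom_K (Neg a) (Neg (Or a b))) h1; move: (axiom_dual a) (axiom_dual (Or a b)).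
move=> d1 d2 /(_ (Imp (Dia (Neg (Neg (Or a b)))) (Or (Dia (Neg (Neg a))) (Dia b)))) h2.
apply: (taut3 (h2 _) d1 d2); last by truth_table.
by truth_table.
Qed.

Lemma Ex_intro p b a : L (Imp (subst1 p b a) (Ex p a)).
Proof. exact: npqml_inst. Qed.

Lemma subst1_Var p a : subst1 p (Var p) a = a.
Proof. by apply: subst_id => r _ /=; case: eqVneq => [->|]. Qed.

Lemma Ex_intro_same p a : L (Imp a (Ex p a)).
Proof. by have := Ex_intro p (Var p) a; rewrite subst1_Var. Qed.

Lemma Ex_mono p a b : L (Imp a b) -> L (Imp (Ex p a) (Ex p b)).
Proof.
move=> ab; apply: (npqml_ex hL); last by rewrite free_vars_Ex eqxx.
exact: Imp_trans ab (Ex_intro_same p b).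
Qed.

Definition interderivable a b := L (Imp a b) /\ L (Imp b a).

Lemma interderivable_refl a : interderivable a a.
Proof. by split; apply: Imp_refl. Qed.

Lemma interderivable_trans a b c : interderivable a b -> interderivable b c -> interderivable a c.
Proof.
by move=> [ab ba] [bc cb]; split; [apply: Imp_trans bc|apply: Imp_trans ba].
Qed.

(* Bound variables may be renamed differently on the two sides, hence only    *)
(* provable equivalence.                                                      *)
Lemma subst_comp t s a :
  interderivable (subst t (subst s a)) (subst (fun r => subst t (s r)) a).
Proof.
elim: a t s => [q|b IH|b IHb c IHc|b IH|p b IH] t s.
- exact: interderivable_refl.
- by have [h1 h2] := IH t s; split; [apply: (taut1 h2)|apply: (taut1 h1)]; truth_table.
- have [h1 h2] := IHb t s; have [h3 h4] := IHc t s.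
  by split; [apply: (taut2 h1 h3)|apply: (taut2 h2 h4)]; truth_table.
- by have [h1 h2] := IH t s; split; apply: Dia_mono.
pose u r := subst t (s r).
pose fresh_for q := forall r, r \in free_vars b -> r != p -> q \notin free_vars (u r).
(* The choice of an admissible bound variable does not matter; both sides can then be compared at
   [q']. *)
have rename q1 q2 : fresh_for q1 -> fresh_for q2 ->
    L (Imp (Ex q1 (subst [eta u with p |-> Var q1] b))
           (Ex q2 (subst [eta u with p |-> Var q2] b))).
  move=> f1 f2; apply: (npqml_ex hL).
    apply: Imp_trans (Ex_intro q2 (Var q1) _).
    have [_] := IH [eta Var with q2 |-> Var q1] [eta u with p |-> Var q2].
    congr (L (Imp _ _)); apply: eq_subst => r rb /=.
    case: eqVneq => rp /=; first by rewrite eqxx.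
    exact: (subst1_id _ (f2 r rb rp)).
  rewrite free_vars_Ex negb_and negbK.
  case: eqVneq => //= q12; apply/negP => /free_vars_subst [r rb] /=.
  case: eqVneq => rp; first by rewrite inE (negbTE q12).
  by apply/negP/f1.
rewrite !subst_Ex.
set q := bound_var s p b; set q' := bound_var t q _; set q'' := bound_var _ p b.
have f'' : fresh_for q'' by move=> r rb rp; apply: bound_var_notin.
have f' : fresh_for q'.
  move=> r rb rp; apply/negP => /free_vars_subst [x xr]; apply/negP.
  apply: bound_var_notin.
    by apply: (mem_free_vars_subst rb); rewrite /= (negbTE rp).
  by apply: contraNneq (bound_var_notin s rb rp) => xq; rewrite -/q -xq.
have e : subst (fun r => subst [eta t with q |-> Var q']
           ([eta s with p |-> Var q] r)) b = subst [eta u with p |-> Var q'] b.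
  apply: eq_subst => r rb /=; case: eqVneq => rp /=; first by rewrite eqxx.
  apply: eq_subst => x xr /=; case: eqVneq => // xq.
  by have := bound_var_notin s rb rp; rewrite -/q -xq xr.
have [h1 h2] := IH [eta t with q |-> Var q'] [eta s with p |-> Var q].
rewrite e in h1 h2; apply: (@interderivable_trans _ (Ex q' (subst [eta u with p |-> Var q'] b))).
  by split; apply: Ex_mono.
by split; apply: rename.
Qed.

Lemma subst1_rename p q b c : q \notin free_vars b ->
  interderivable (subst1 q c (subst1 p (Var q) b)) (subst1 p c b).
Proof.
move=> qb; have := subst_comp [eta Var with q |-> c] [eta Var with p |-> Var q] b.
congr (interderivable _ _); apply: eq_subst => r rb /=.
case: eqVneq => /= _; first by rewrite eqxx.
by case: eqVneq => // rq; rewrite -rq rb in qb.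
Qed.

Lemma Ex_rename p q b : q \notin free_vars b ->
  L (Imp (Ex p b) (Ex q (subst1 p (Var q) b))).
Proof.
move=> qb; apply: (npqml_ex hL).
  have [_ h] := subst1_rename p (Var p) qb.
  by rewrite subst1_Var in h; apply: Imp_trans h (Ex_intro _ _ _).
rewrite free_vars_Ex negb_and negbK; case: eqVneq => //= pq.
apply/negP => /free_vars_subst [r rb] /=; case: eqVneq => rp.
  by rewrite inE (negbTE pq).
by rewrite inE eq_sym (negbTE rp).
Qed.

(** * Witnessed maximal consistent sets *)

(** [world_Neg] is consistency and maximality together. Witnesses are arbitrary formulas because
    canonical propositions are extensions of formulas. *)
Record is_world (w : set form) : Prop := IsWorld {
  world_thm : L `<=` w;
  world_mp : forall a b, w a -> w (Imp a b) -> w b;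
  world_Neg : forall a, w (Neg a) <-> ~ w a;
  world_witness : forall p a, w (Ex p a) -> exists b, w (subst1 p b a)
}.

Fixpoint form_tree (a : form) : GenTree.tree nat :=
  match a with
  | Var p => GenTree.Leaf p
  | Neg b => GenTree.Node 0 [:: form_tree b]
  | Or b c => GenTree.Node 1 [:: form_tree b; form_tree c]
  | Dia b => GenTree.Node 2 [:: form_tree b]
  | Ex p b => GenTree.Node 3 [:: GenTree.Leaf p; form_tree b]
  end.

Fixpoint tree_form (t : GenTree.tree nat) : form :=
  match t with
  | GenTree.Leaf p => Var p
  | GenTree.Node 0 [:: b] => Neg (tree_form b)
  | GenTree.Node 1 [:: b; c] => Or (tree_form b) (tree_form c)
  | GenTree.Node 2 [:: b] => Dia (tree_form b)
  | GenTree.Node 3 [:: GenTree.Leaf p; b] => Ex p (tree_form b)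
  | _ => Var 0
  end.

Lemma form_treeK : cancel form_tree tree_form.
Proof. by elim=> //= [b ->|b -> c ->|b ->|p b ->]. Qed.

Lemma form_enumeration : exists f : nat -> form, forall a, exists n, f n = a.
Proof.
exists (fun n => tree_form (odflt (GenTree.Leaf 0) (unpickle n))) => a.
by exists (pickle (form_tree a)); rewrite pickleK form_treeK.
Qed.

(* A common form of Lindenbaum's lemma for the two instances needed: the      *)
(* formulas consistent with [L], and the formulas possible at a world.        *)
Section Lindenbaum.
Variable Con : set form.
Hypothesis Con_mono : forall a b, L (Imp a b) -> Con a -> Con b.
Hypothesis Con_contra : forall a, ~ Con (And a (Neg a)).
Hypothesis Con_split :
  forall a b, Con a -> Con (And a b) \/ Con (And a (Neg b)).
Hypothesis Con_witness :
  forall a p b, Con (And a (Ex p b)) -> exists c, Con (And a (subst1 p c b)).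

(** The theory built so far is kept as one formula, so a property [Con] of single formulas suffices;
    a stage decides [b] and adds a witness if [b] is an accepted existential. *)
Lemma Con_step a b : Con a ->
  exists a', [/\ Con a', L (Imp a' a) &
    L (Imp a' (Neg b)) \/ L (Imp a' b) /\
      forall p c, b = Ex p c -> exists d, L (Imp a' (subst1 p d c))].
Proof.
case/(Con_split b) => h; last first.
  exists (And a (Neg b)); split=> //; last left;
    by apply: (npqml_taut hL); truth_table.
have [[p [c bE]]|nEx] := pselect (exists p c, b = Ex p c); last first.
  exists (And a b); split=> //; last right.
    by apply: (npqml_taut hL); truth_table.
  split; first by apply: (npqml_taut hL); truth_table.
  by move=> p c bE; case: nEx; exists p, c.
rewrite {}bE in h *; have [d hd] := Con_witness h.
exists (And a (subst1 p d c)); split=> //; last right.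
  by apply: (npqml_taut hL); truth_table.
split.
  by apply: (taut1 (Ex_intro p d c)); truth_table.
move=> _ _ [<- <-]; exists d; by apply: (npqml_taut hL); truth_table.
Qed.

Lemma lindenbaum a0 : Con a0 ->
  exists w, [/\ is_world w, w a0 & w `<=` Con].
Proof.
move=> Ca0; have [f f_surj] := form_enumeration.
have [g gP] : {g : form -> form -> form | forall a b, Con a ->
    [/\ Con (g a b), L (Imp (g a b) a) &
    L (Imp (g a b) (Neg b)) \/ L (Imp (g a b) b) /\
      forall p c, b = Ex p c -> exists d, L (Imp (g a b) (subst1 p d c))]}.
  apply: cid; have /choice[g gP] : forall ab : form * form, exists a', Con ab.1 ->
    [/\ Con a', L (Imp a' ab.1) &
    L (Imp a' (Neg ab.2)) \/ L (Imp a' ab.2) /\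
      forall p c, ab.2 = Ex p c -> exists d, L (Imp a' (subst1 p d c))].
    move=> [a b] /=; have [/(Con_step b)[a' ?]|?] := pselect (Con a);
      by [exists a'|exists a].
  by exists (fun a b => g (a, b)) => a b; apply: (gP (a, b)).
(* [s n] implies its predecessors and decides the first [n] formulas of the enumeration; the world
   consists of all consequences of the chain. *)
pose s := fix s n := if n is m.+1 then g (s m) (f m) else a0.
have Cs n : Con (s n) by elim: n => //= n /(gP _ (f n))[].
have sP n := gP (s n) (f n) (Cs n).
have s_mono m n : n <= m -> L (Imp (s m) (s n)).
  elim: m => [|m IH]; first by rewrite leqn0 => /eqP ->; apply: Imp_refl.
  rewrite leq_eqVlt => /predU1P[->|/IH h]; first exact: Imp_refl.
  by apply: Imp_trans h; have [] := sP m.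
pose w := [set b | exists n, L (Imp (s n) b)].
have wC : w `<=` Con by move=> b [n /Con_mono]; apply.
have w_or b : w b \/ w (Neg b).
  by have [n <-] := f_surj b; have [_ _ [|[]]] := sP n; [right|left]; exists n.+1.
have wmp a b : w a -> w (Imp a b) -> w b.
  move=> [m ha] [n hab]; exists (maxn m n).
  have h1 := s_mono _ _ (leq_maxl m n); have h2 := s_mono _ _ (leq_maxr m n).
  by apply: (taut2 (Imp_trans h1 ha) (Imp_trans h2 hab)); truth_table.
have wL : L `<=` w by move=> b Lb; exists 0; apply: (taut1 Lb); truth_table.
have wneg a : w (Neg a) <-> ~ w a.
  split=> [wna wa|]; last by case: (w_or a).
  apply: (@Con_contra a); apply: wC; apply: (wmp _ _ wna); apply: (wmp _ _ wa); apply: wL.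
  by apply: (npqml_taut hL); truth_table.
exists w; split=> //; last by exists 0; apply: Imp_refl.
split=> // p a wEx; have [n fn] := f_surj (Ex p a).
have [_ _ [h|[_ /(_ p a fn)[d hd]]]] := sP n; last by exists d, n.+1.
have /wneg // : w (Neg (Ex p a)) by rewrite -fn; exists n.+1.
Qed.

End Lindenbaum.

Lemma fresh_for2 a b :
  exists q, q \notin free_vars a /\ q \notin free_vars b.
Proof.
exists (fresh (free_vars a ++ free_vars b)); apply/andP.
by rewrite -negb_or -mem_cat fresh_notin.
Qed.

Lemma consistent_world a : ~ L (Neg a) -> exists2 w, is_world w & w a.
Proof.
move=> Ca; pose Con := [set b | ~ L (Neg b)].
have [||||w [] ? ? _] := @lindenbaum Con _ _ _ _ a Ca; last by exists w.
- by move=> {Ca}a b ab Ca Lb; apply: Ca; apply: (taut2 ab Lb); truth_table.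
- by move=> b; apply; apply: (npqml_taut hL); truth_table.
- move=> {Ca}a b Ca; apply: contrapT => /not_orP[] /contrapT h1 /contrapT h2.
  by apply: Ca; apply: (taut2 h1 h2); truth_table.
move=> {Ca}a p b Cab; have [q [qa qb]] := fresh_for2 a b.
(* A fresh variable is a witness: if [L] refuted it, quantifying it away would refute
   [And a (Ex p b)]. *)
exists (Var q) => h; apply: Cab.
have {}h : L (Imp (Ex q (subst1 p (Var q) b)) (Neg a)).
  by apply: (npqml_ex hL) => //; apply: (taut1 h); truth_table.
by apply: (taut2 h (Ex_rename p qb)); truth_table.
Qed.

Lemma world_Imp w a b : is_world w -> L (Imp a b) -> w a -> w b.
Proof. by move=> hw ab wa; apply: (world_mp hw) wa _; apply: world_thm. Qed.

Lemma world_Or w a b : is_world w -> w (Or a b) <-> w a \/ w b.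
Proof.
move=> hw; split; last first.
  by case; apply: (world_Imp hw); apply: (npqml_taut hL); truth_table.
move=> wab; have [wa|/(world_Neg hw) wna] := pselect (w a); [by left|right].
apply: (world_mp hw wna); apply: (world_mp hw wab); apply: (world_thm hw).
by apply: (npqml_taut hL); truth_table.
Qed.

Lemma world_Ex w p a : is_world w -> w (Ex p a) <-> exists b, w (subst1 p b a).
Proof.
move=> hw; split=> [|[b]]; first exact: (world_witness hw).
exact: (world_Imp hw (Ex_intro p b a)).
Qed.

Hypothesis L_Bc : axBc `<=` L.

(* The Barcan axiom moves the existential quantifier outside the diamond,     *)
(* where the witness is provided by [w].                                      *)
Lemma possible_world w a : is_world w -> w (Dia a) ->
  exists u, [/\ is_world u, u a & forall b, u b -> w (Dia b)].
Proof.
move=> hw wa; pose Con := [set b | w (Dia b)].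
have [||||u [] ? ? ?] := @lindenbaum Con _ _ _ _ a wa; last by exists u.
- by move=> {wa}a b /Dia_mono/(world_Imp hw); apply.
- move=> b /=; apply/(world_Neg hw); apply: (world_thm hw).
  have h := npqml_nec hL (npqml_taut hL (_ : tautology (Neg (And b (Neg b))))).
  apply: (taut2 (h _) (axiom_dual (And b (Neg b)))); last by truth_table.
  by truth_table.
- move=> {wa}a b wa; apply/(world_Or _ _ hw); move: wa; apply: (world_Imp hw).
  apply: Imp_trans (Dia_Or _ _); apply: Dia_mono.
  by apply: (npqml_taut hL); truth_table.
move=> {wa}a p b wab; have [q [qa qb]] := fresh_for2 a b.
pose b' := subst1 p (Var q) b.
(* Since [q] is fresh for [a], the quantifier can be pulled over the conjunction. *)
have : w (Dia (Ex q (And a b'))).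
  apply: (world_Imp hw) wab; apply: Dia_mono.
  have h : L (Imp (Ex q b') (Imp a (Ex q (And a b')))).
    apply: (npqml_ex hL).
      by apply: (taut1 (Ex_intro_same q (And a b'))); truth_table.
    by rewrite /= mem_cat mem_filter eqxx orbF.
  by apply: (taut2 h (Ex_rename p qb)); truth_table.
have /(world_Imp hw) /[apply] : L (Imp (Dia (Ex q (And a b'))) (Ex q (Dia (And a b')))).
  by apply: L_Bc; exists q, (And a b').
case/(world_witness hw) => c.
have -> : subst1 q c (Dia (And a b')) = Dia (And (subst1 q c a) (subst1 q c b')) by [].
rewrite subst1_id // => h; exists c; apply: (world_Imp hw) h; apply: Dia_mono.
have [h _] := subst1_rename p c qb; by apply: (taut1 h); truth_table.
Qed.

End Logic.

(** * Counting game *)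

Section Counting.
Variable T : eqType.
Implicit Types (S D : set T) (s t : seq T).

Definition atleast S k := exists s, [/\ uniq s, size s = k & {in s, forall x, S x}].

Lemma atleast_le S j k : j <= k -> atleast S k -> atleast S j.
Proof.
move=> jk [s [us sk sS]]; exists (take j s); split; first exact: take_uniq.
  by rewrite size_takel // sk.
by move=> x /mem_take; apply: sS.
Qed.

Lemma atleast_seq S s k : uniq s -> (forall x, S x <-> x \in s) ->
  atleast S k <-> k <= size s.
Proof.
move=> us Ss; split=> [[t [ut <- tS]]|kS].
  by apply: uniq_leq_size => // x /tS /Ss.
by apply: (atleast_le kS); exists s; split=> // x /Ss.
Qed.

Lemma not_atleast_seq S k : ~ atleast S k ->
  exists s, [/\ uniq s, size s < k & forall x, S x <-> x \in s].
Proof.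
elim: k => [|k IH] h; first by case: h; exists [::].
have [[s [us sk sS]]|/IH[s [us sk sS]]] := pselect (atleast S k); last first.
  by exists s; split=> //; apply: ltnW.
exists s; rewrite sk; split=> // x; split=> [Sx|/sS //].
apply: contrapT => /negP xs; apply: h; exists (x :: s); rewrite /= sk xs.
by split=> // y; rewrite inE => /predU1P[->|/sS].
Qed.

Lemma atleast_setD S s k : uniq s -> {in s, forall x, S x} ->
  atleast [set x | S x /\ x \notin s] k <-> atleast S (k + size s).
Proof.
move=> us sS; split=> [[t [ut tk tS]]|[t [ut tk tS]]].
  exists (t ++ s); split; last first.
  - by move=> x; rewrite mem_cat => /orP[/tS[]|/sS].
  - by rewrite size_cat tk.
  - rewrite cat_uniq ut us andbT; apply/hasPn => x xs.
    by apply/negP => /tS[]; rewrite xs.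
apply: (@atleast_le _ _ (size [seq x <- t | x \notin s])).
  rewrite size_filter -(leq_add2r (size s)) -tk -(count_predC (mem s) t) addnC.
  rewrite leq_add2l -size_filter; apply: uniq_leq_size; first exact: filter_uniq.
  by move=> x; rewrite mem_filter => /andP[].
exists [seq x <- t | x \notin s]; split=> //; first exact: filter_uniq.
by move=> x; rewrite mem_filter => /andP[xs /tS].
Qed.

Definition same_count N S S' :=
  forall j, j <= N -> atleast S j <-> atleast S' j.

(** If one half of [S] has fewer than [N] points, a list [t] of the same size is cut from [S'], and
    the remainders still agree up to [N]. If both halves have at least [N], then [S'] has [N + N]
    points and [t] takes [N] of them. The Boolean tells which half [t] stands for. *)
Lemma split_count N S S' D : same_count (N + N) S S' ->
  exists t (b : bool),
    same_count N [set x | S x /\ D x] [set x | S' x /\ (x \in t) = b] /\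
    same_count N [set x | S x /\ ~ D x] [set x | S' x /\ (x \in t) = ~~ b].
Proof.
move=> SS'; have small E : ~ atleast [set x | S x /\ E x] N -> exists t,
    same_count N [set x | S x /\ E x] [set x | S' x /\ x \in t] /\
    same_count N [set x | S x /\ ~ E x] [set x | S' x /\ (x \in t) = false].
  case/not_atleast_seq => s [us sN sP].
  have sS : {in s, forall x, S x} by move=> x /sP[].
  have [t [ut ts tS']] : atleast S' (size s).
    by apply/SS'; [apply/(leq_trans (ltnW sN))/leq_addr|exists s].
  exists t; split=> j jN.
    rewrite (atleast_seq _ us sP) -ts; apply: iff_sym; apply: atleast_seq => //.
    by move=> x; split=> [[]//|xt]; split=> //; apply: tS'.
  have -> : [set x | S' x /\ (x \in t) = false] = [set x | S' x /\ x \notin t].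
    by apply/seteqP; split=> x /= [Sx h]; split=> //; [exact: negbT|exact: negbTE].
  rewrite (atleast_setD _ ut tS') ts -SS' ?leq_add ?(ltnW sN) //.
  rewrite -(atleast_setD _ us sS); suff -> :
    [set x | S x /\ ~ E x] = [set x | S x /\ x \notin s] by [].
  apply/seteqP; split=> x /= [Sx h]; split=> //.
    by apply/negP => /sP[].
  by move=> Ex; move/negP: h; apply; apply/sP.
have [/small[t [h1 h2]]|h1] := pselect (~ atleast [set x | S x /\ D x] N).
  by exists t, true.
have [/small[t [h2 h3]]|h2] := pselect (~ atleast [set x | S x /\ ~ D x] N).
  exists t, false; split=> //.
  suff -> : [set x | S x /\ D x] = [set x | S x /\ ~ ~ D x] by [].
  by apply/seteqP; split=> x /=; rewrite notE.
move: h1 h2 => /contrapT h1 /contrapT h2.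
have [s1 [us1 s1N s1S]] := h1; have [s2 [us2 s2N s2S]] := h2.
have [t [ut tN tS']] : atleast S' (N + N).
  apply/SS' => //; exists (s1 ++ s2); split.
  - rewrite cat_uniq us1 us2 andbT /=; apply/hasPn => x /s2S[_ Dx].
    by apply/negP => /s1S[].
  - by rewrite size_cat s1N s2N.
  - by move=> x; rewrite mem_cat => /orP[/s1S|/s2S] [].
have ut' := ut; rewrite -(cat_take_drop N t) cat_uniq in ut'.
case/and3P: ut' => ut1 /hasPn disj ut2.
exists (take N t), true; split=> j jN; split=> _.
- apply: (atleast_le jN); exists (take N t); split=> //.
    by rewrite size_takel // tN leq_addr.
  by move=> x xt; split=> //; apply/tS'/(mem_take xt).
- exact: atleast_le h1.
- apply: (atleast_le jN); exists (drop N t); split=> //.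
    by rewrite size_drop tN addnK.
  by move=> x xt; split; [apply/tS'/(mem_drop xt)|apply/negbTE/disj].
- exact: atleast_le h2.
Qed.

Definition matches (K : eqType) N (c c' : T -> K) :=
  forall s, uniq s -> size s <= N -> exists s', uniq s' /\ map c' s' = map c s.

Definition similar (K : eqType) N (c c' : T -> K) :=
  matches N c c' /\ matches N c' c.

Lemma similar_sym (K : eqType) N (c c' : T -> K) :
  similar N c c' -> similar N c' c.
Proof. by case. Qed.

Lemma similar_refl (K : eqType) N (c : T -> K) : similar N c c.
Proof. by split=> s us _; exists s. Qed.

Lemma similar_le (K : eqType) M N (c c' : T -> K) :
  M <= N -> similar N c c' -> similar M c c'.
Proof.
by move=> MN [h h']; split=> s us sM; [apply: h|apply: h'] => //;
  apply: leq_trans MN.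
Qed.

Lemma similar_map (K K' : eqType) N (f : K -> K') (c c' : T -> K) :
  similar N c c' -> similar N (f \o c) (f \o c').
Proof.
by move=> [h h']; split=> s us sN; [have [t [ut e]] := h s us sN|
  have [t [ut e]] := h' s us sN]; exists t; rewrite ut (map_comp f) e -map_comp.
Qed.

Lemma similar_cells (K : eqType) N (c c' : T -> K) :
  similar N c c' <->
  forall k, same_count N [set x | c x = k] [set x | c' x = k].
Proof.
have half1 (d d' : T -> K) : matches N d d' -> forall k j, j <= N ->
    atleast [set x | d x = k] j -> atleast [set x | d' x = k] j.
  move=> h k j jN [s [us sj sk]]; have [|t [ut e]] := h s us; first by rewrite sj.
  exists t; rewrite ut -(size_map d' t) e size_map; split=> // x xt /=.
  have /mapP[y ys ->] : d' x \in map d s by rewrite -e map_f.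
  exact: sk.
have half2 (d d' : T -> K) : (forall k j, j <= N ->
    atleast [set x | d x = k] j -> atleast [set x | d' x = k] j) ->
    matches N d d'.
  move=> h; elim=> [|x s IH] /=; first by exists [::].
  case/andP=> xs us sN; have [t [ut e]] := IH us (ltnW sN).
  pose s1 := x :: [seq y <- s | d y == d x].
  have s1N : size s1 <= N.
    by apply: leq_trans sN; rewrite /= ltnS size_filter count_size.
  have [|r [ur sr rP]] := h (d x) _ s1N.
    exists s1; split=> //=; first by rewrite mem_filter (negbTE xs) andbF filter_uniq.
    by move=> y; rewrite inE mem_filter => /predU1P[->|/andP[/eqP]].
  have : ~~ all (fun y => y \in [seq z <- t | d' z == d x]) r.
    apply: contraL (leqnn (size r)) => /allP /(uniq_leq_size ur) h'.
    rewrite -ltnNge; apply: leq_ltn_trans h' _.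
    rewrite sr /s1 /= ltnS !size_filter -(count_map d' (pred1 (d x))) e.
    by rewrite count_map.
  case/allPn => y yr; rewrite mem_filter rP // eqxx /= => yt.
  by exists (y :: t); rewrite /= yt ut e rP.
split=> [[h1 h2] k j jN|h]; first by split; apply: half1.
by split; apply: half2 => k j jN; apply h.
Qed.

Definition refine (K : eqType) (c : T -> K) (D : set T) : T -> K * bool :=
  fun x => (c x, `[< D x >]).

(** The answer to a set move, given cell by cell by [split_count] at the cost of half the threshold;
    it is finite or cofinite in each cell of [c']. *)
Lemma similar_refine (K : eqType) N (c c' : T -> K) D :
  similar (N + N) c c' -> exists (t : K -> seq T) (b : K -> bool),
  similar N (refine c D)
    (refine c' [set x | (x \in t (c' x)) = b (c' x)]).
Proof.
move=> /similar_cells cc'.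
have /choice[tb tbP] : forall k, exists tb : seq T * bool,
    same_count N [set x | c x = k /\ D x] [set x | c' x = k /\ (x \in tb.1) = tb.2] /\
    same_count N [set x | c x = k /\ ~ D x] [set x | c' x = k /\ (x \in tb.1) = ~~ tb.2].
  by move=> k; have [t [b h]] := split_count D (cc' k); exists (t, b).
exists (fun k => (tb k).1), (fun k => (tb k).2); apply/similar_cells => -[k d].
have [h1 h2] := tbP k; case: d.
- suff [-> ->] : [set x | refine c D x = (k, true)] = [set x | c x = k /\ D x] /\
    [set x | refine c' [set x | (x \in (tb (c' x)).1) = (tb (c' x)).2] x = (k, true)]
    = [set x | c' x = k /\ (x \in (tb k).1) = (tb k).2] by [].
  split; apply/seteqP; split=> x /=.
  + by case=> -> /asboolP.
  + by case=> <- Dx; rewrite /refine (asboolT Dx).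
  + by case=> <- /asboolP.
  + by case=> <- h; rewrite /refine (asboolT h).
- suff [-> ->] : [set x | refine c D x = (k, false)] = [set x | c x = k /\ ~ D x] /\
    [set x | refine c' [set x | (x \in (tb (c' x)).1) = (tb (c' x)).2] x = (k, false)]
    = [set x | c' x = k /\ (x \in (tb k).1) = ~~ (tb k).2] by [].
  split; apply/seteqP; split=> x /=.
  + by case=> -> /asboolP.
  + by case=> <- Dx; rewrite /refine (asboolF Dx).
  + by case=> <- /asboolP h; split=> //; case: (tb _).2 h; case: (_ \in _).
  + by case=> <- h; rewrite /refine asboolF //= h; case: (_.2).
Qed.

(* The game is only sensitive to finitely many classes of points, the values  *)
(* of [zone], because accessibility depends on the zones alone.               *)
Section Game.
Variables (R : T -> T -> Prop) (Z : finType) (zone : T -> Z).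
Hypothesis R_zone : forall x y x' y',
  zone x = zone x' -> zone y = zone y' -> R x y -> R x' y'.
Variable m : nat.
Implicit Type v : nat -> set T.

(** The last component makes the current world [x] a one-point cell. There are finitely many
    colours. *)
Definition color v x y : {ffun 'I_m -> bool} * Z * bool :=
  ([ffun i : 'I_m => `[< v i y >]], zone y, y == x).

(** Doubled at each move, to pay for [similar_refine]; at least 2, so that one-point cells are
    recognized. *)
Fixpoint pebbles a :=
  match a with
  | Var _ => 2
  | Neg b => pebbles b
  | Or b c => maxn (pebbles b) (pebbles c)
  | Dia b | Ex _ b => pebbles b + pebbles b
  end.

Lemma pebbles_ge2 a : 1 < pebbles a.
Proof.
elim: a => //= [b hb c hc|b hb|p b hb]; first by rewrite leq_max hb.
  exact: leq_trans (leq_addr _ _).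
exact: leq_trans (leq_addr _ _).
Qed.

Lemma color_point v v' x x' : matches 1 (color v x) (color v' x') ->
  color v x x = color v' x' x'.
Proof.
move=> h; have [s [_]] := h [:: x] isT isT.
case: s => [//|y [|//]] [h1 h2].
rewrite eqxx => /eqP yx; rewrite /color -{1 2}yx h1 h2 !eqxx //.
Qed.

Lemma color_update N v v' x x' p D D' :
  similar N (refine (color v x) D) (refine (color v' x') D') ->
  similar N (color [eta v with p |-> D] x) (color [eta v' with p |-> D'] x').
Proof.
(* The new colour is a function of the old one and of membership in the new set. *)
pose f (k : {ffun 'I_m -> bool} * Z * bool * bool) :=
  ([ffun i : 'I_m => if i == p :> nat then k.2 else k.1.1.1 i], k.1.1.2, k.1.2).
have e u y E : color [eta u with p |-> E] y = f \o refine (color u y) E.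
  apply/funext => z; rewrite /color /f /refine /=; congr (_, _, _).
  by apply/ffunP => i; rewrite !ffunE /=; case: eqP.
by rewrite !e; apply: similar_map.
Qed.

(** Moving to the world [y] is treated as the set move of its singleton; threshold 2 forces the
    answer [D] to be a singleton as well. *)
Lemma color_move N v v' x x' y D : 1 < N ->
  similar N (refine (color v x) [set y]) (refine (color v' x') D) ->
  exists y', [/\ similar N (color v y) (color v' y'), zone y = zone y' & zone x = zone x'].
Proof.
move=> N1 sim; have [s1 s2] := sim.
have [s [_]] := s1 [:: y] isT (ltnW N1).
case: s => [//|y' [|//]] [_ zy _]; rewrite (@asboolT ([set y] y)) // => /asboolP Dy'.
exists y'; split=> //; last first.
  have /color_point [] : matches 1 (color v x) (color v' x'); last by [].
  have [+ _] := similar_map fst sim; move=> h s us ss; apply: h => //.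
  exact: leq_trans (ltnW N1).
have DE : D = [set y'].
  apply/seteqP; split=> [z Dz|_ ->//] /=; apply: contrapT => nzy.
  have u2 : uniq [:: y'; z] by rewrite /= inE andbT eq_sym; apply/eqP.
  have [s [us]] := s2 _ u2 N1; case: s us => [//|a [//|b [|//]]] ab.
  case=> _ _ _ + _ _ _; rewrite (asboolT Dy') (asboolT Dz).
  by move=> /asboolP ay /asboolP bY; rewrite /= ay bY inE eqxx in ab.
pose f (k : {ffun 'I_m -> bool} * Z * bool * bool) := (k.1.1, k.2).
have e u w z : color u z = f \o refine (color u w) [set z].
  apply/funext => i; rewrite /color /f /refine /=; congr (_, _).
  by apply/idP/asboolP => /eqP.
by rewrite (e v x y) (e v' x' y') -DE; apply: similar_map.
Qed.

Lemma similar_geval a v v' x x' : {in used_vars a, forall p, p < m} ->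
  similar (pebbles a) (color v x) (color v' x') ->
  geval R setT v a x -> geval R setT v' a x'.
Proof.
elim: a v v' x x' => [p|b IH|b IHb c IHc|b IH|p b IH] v v' x x' am sim.
- have [sim' _] := similar_le (isT : 1 <= 2) sim.
  have pm : p < m by apply: am; rewrite inE.
  have [/ffunP/(_ (Ordinal pm))] := color_point sim'; rewrite !ffunE /= => e _.
  by move=> _ /= /asboolP; rewrite e => /asboolP.
- move=> /= h h'; apply: h; move: h'; apply: IH => //; exact: similar_sym.
- case=> h; [left|right].
    apply: IHb h; last exact: similar_le (leq_maxl _ _) sim.
    by move=> p pb; apply: am; rewrite /= mem_cat pb.
  apply: IHc h; last exact: similar_le (leq_maxr _ _) sim.
  by move=> p pb; apply: am; rewrite /= mem_cat pb orbT.
- case=> y xy h; have [t [d /(color_move (pebbles_ge2 b))]] := similar_refine [set y] sim.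
  case=> y' [sim' zy zx]; exists y'; first exact: R_zone xy.
  exact: IH h.
case=> D _ h; have [t [d sim']] := similar_refine D sim.
set D' := [set _ | _] in sim'; exists D' => //.
apply: IH h; first by move=> q qb; apply: am; rewrite inE qb orbT.
exact: color_update.
Qed.

(* In a field of sets containing the singletons and the zones, arbitrary sets *)
(* can be approximated: a cell of a colouring need only be cut into a finite  *)
(* and a cofinite part.                                                       *)
Variable B : set (set T).
Hypothesis B_setC : forall X, B X -> B (~` X).
Hypothesis B_setU : forall X Y, B X -> B Y -> B (X `|` Y).
Hypothesis B_set1 : forall x, B [set x].
Hypothesis B_zone : forall z, B [set x | zone x = z].

Lemma field_setT : T -> B setT.
Proof. by move=> x; rewrite -(setUv [set x]); apply/B_setU/B_setC. Qed.

Lemma field_set0 : T -> B set0.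
Proof. by move=> x; rewrite -setCT; apply/B_setC/field_setT. Qed.

Lemma field_setI X Y : B X -> B Y -> B (X `&` Y).
Proof. by move=> BX BY; rewrite -(setCK (_ `&` _)) setCI; apply/B_setC/B_setU; apply: B_setC. Qed.

Lemma field_seq (s : seq T) : T -> B [set` s].
Proof.
move=> x0; elim: s => [|x s IH].
  by rewrite (_ : [set` _] = set0); [apply: field_set0|apply/seteqP; split].
rewrite (_ : [set` _] = [set x] `|` [set` s]); first exact: B_setU.
by apply/seteqP; split=> y /=; rewrite inE => /predU1P.
Qed.

Lemma field_bigcap (I : finType) (F : I -> set T) : T ->
  (forall i, B (F i)) -> B [set x | forall i, F i x].
Proof.
move=> x0 BF; have h (s : seq I) : B [set x | forall i, i \in s -> F i x].
  elim: s => [|i s IH].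
    by rewrite (_ : [set _ | _] = setT); [apply: field_setT|apply/seteqP; split].
  rewrite (_ : [set _ | _] = F i `&` [set x | forall i, i \in s -> F i x]).
    exact: field_setI.
  apply/seteqP; split=> x /= => [h|[Fx h] j].
    by split=> [|j js]; apply: h; rewrite inE ?eqxx ?js ?orbT.
  by rewrite inE => /predU1P[->|/h].
rewrite (_ : [set _ | _] = [set x | forall i, i \in enum I -> F i x]) //.
by apply/seteqP; split=> x /= hx i; [move=> _; apply: hx|apply: hx; rewrite mem_enum].
Qed.

Lemma field_asbool X (b : bool) : B X -> B [set y | `[< X y >] = b].
Proof.
case: b => BX.
  by rewrite (_ : [set _ | _] = X) //; apply/seteqP; split=> y /asboolP.
rewrite (_ : [set _ | _] = ~` X); first exact: B_setC.
by apply/seteqP; split=> y /=; [move/negbT/asboolPn|move=> nX; apply/asboolF].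
Qed.

Lemma field_color v x k : (forall p, B (v p)) -> B [set y | color v x y = k].
Proof.
move=> Bv; rewrite (_ : [set _ | _] = [set y | forall i : 'I_m, `[< v i y >] = k.1.1 i] `&`
  [set y | zone y = k.1.2] `&` [set y | `[< [set x] y >] = k.2]).
  by apply: field_setI; [apply: field_setI => //; apply: field_bigcap => // i|]; apply: field_asbool.
have e y : `[< [set x] y >] = (y == x) by apply/asboolP/eqP.
apply/seteqP; split=> y /=; rewrite e.
  by move=> <-; split=> //; split=> // i; rewrite ffunE.
case: k => [[f z] d] /= [[h <-] <-]; congr (_, _, _).
by apply/ffunP => i; rewrite ffunE h.
Qed.

Lemma approximate v x a p D : (forall q, B (v q)) ->
  {in used_vars a, forall q, q < m} ->
  geval R setT [eta v with p |-> D] a x ->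
  exists2 X, B X & geval R setT [eta v with p |-> X] a x.
Proof.
move=> Bv am h.
(* The position is played against itself, with [D] as the set move. *)
have [t [b sim]] := similar_refine D (similar_refl (pebbles a + pebbles a) (color v x)).
set X := [set _ | _] in sim; exists X; last first.
  by apply: similar_geval am _ h; apply: color_update.
(* [F k] constrains only the cell of colour [k]; [X] is the intersection of these finitely many
   sets. *)
pose F k := ~` ([set y | color v x y = k] `&` [set y | (y \in t k) <> b k]).
rewrite (_ : X = [set y | forall k, F k y]).
  apply: field_bigcap => // k; apply/B_setC/field_setI; first exact: field_color.
  case: (b k); last first.
    rewrite (_ : [set _ | _] = [set` t k]); first exact: field_seq.
    by apply/seteqP; split=> y /=; case: (_ \in _).
  rewrite (_ : [set _ | _] = ~` [set` t k]); first exact/B_setC/field_seq.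
  by apply/seteqP; split=> y /=; case: (_ \in _).
apply/seteqP; split=> y /= h'; first by move=> k [<-].
by apply: contrapT => h''; apply: (h' (color v x y)).
Qed.

End Game.
End Counting.

(** * From general frames to Kripke frames *)

Section Euclidean.
Variables (T : Type) (R : T -> T -> Prop).
Hypothesis R_eucl : euclidean R.
Implicit Types x y z : T.

Lemma eucl_refl x y : R x y -> R y y.
Proof. by move=> xy; apply: (R_eucl xy xy). Qed.

Lemma eucl_step3 x y z t : R x y -> R y z -> R z t -> R y t.
Proof.
by move=> xy yz zt; apply: (R_eucl _ zt); apply: (R_eucl yz); apply: eucl_refl xy.
Qed.

Lemma near_step x y z : near R x y -> R y z -> near R x z.
Proof.
move=> [<-|xy|[t xt ty]] yz; first exact: Or32.
  by apply: Or33; exists y.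
by apply: Or33; exists t => //; apply: eucl_step3 xt ty yz.
Qed.

Lemma near_trans x y z : near R x y -> near R y z -> near R x z.
Proof.
move=> xy [<-//|yz|[t yt tz]]; first exact: near_step yz.
by apply: near_step tz; apply: near_step yt.
Qed.

Lemma near_refl x : near R x x. Proof. exact: Or31. Qed.

(** The universal cluster of the part generated by [u]: accessibility is total on it ([cluster_R]),
    and it contains every near world other than [u] ([cluster_near]). *)
Definition cluster u z := exists2 t, R u t & R t z.

Lemma cluster_near u y : near R u y -> y <> u -> cluster u y.
Proof.
move=> [uy /(_ (esym uy)) //|uy _|[t ut ty] _]; last by exists t.
by exists y => //; apply: eucl_refl uy.
Qed.

Lemma near_succ_cluster u y z : near R u y -> R y z -> cluster u z.
Proof.
move=> [<-|uy|[t ut ty]] yz.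
- by exists z => //; apply: eucl_refl yz.
- by exists y.
- by exists t => //; apply: eucl_step3 ut ty yz.
Qed.

Lemma cluster_R u y z : cluster u y -> cluster u z -> R y z.
Proof.
move=> [t ut ty] [t' ut' t'z]; apply: (R_eucl ty).
by apply: (R_eucl _ t'z); apply: (R_eucl ut' ut).
Qed.

End Euclidean.

(** * Isolated worlds *)

Section GeneralToKripke.
Variables (T : Type) (R : T -> T -> Prop) (B : set (set T)).
Hypothesis R_eucl : euclidean R.
Hypothesis B_geval : forall v a, (forall p, B (v p)) -> B (geval R B v a).
Hypothesis B_separates : forall x y, x <> y -> exists2 X, B X & X x /\ ~ X y.
Hypothesis valid_At2 : forall v x, (forall p, B (v p)) -> geval R B v (axAt 2) x.
Hypothesis valid_R2 : forall v x, (forall p, B (v p)) -> geval R B v (axR 2) x.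
Variables (X0 : set T) (B_X0 : B X0).
Local Notation near := (near R).

Definition isolated u y :=
  near u y /\ exists2 X, B X & forall z, near u z -> X z <-> z = y.

Lemma domain_setC X : B X -> B (~` X).
Proof. by move=> BX; apply: (@B_geval (fun _ => X) (Neg (Var 0))). Qed.

Lemma domain_setU X Y : B X -> B Y -> B (X `|` Y).
Proof.
move=> BX BY; apply: (@B_geval (fun p => if p is 0 then X else Y) (Or (Var 0) (Var 1))).
by case.
Qed.

Lemma domain_setI X Y : B X -> B Y -> B (X `&` Y).
Proof. by move=> BX BY; rewrite -(setCK (_ `&` _)) setCI; apply/domain_setC/domain_setU; apply: domain_setC. Qed.

Lemma domain_setT : B setT.
Proof. by rewrite -(setUv X0); apply/domain_setU/domain_setC. Qed.

(** [axAt 2] gives an atom inside [Y]; as propositions separate worlds, an atom contains a single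
    near world. *)
Lemma isolated_dense u Y : B Y -> (exists2 y, near u y & Y y) ->
  exists2 y, isolated u y & Y y.
Proof.
move=> BY hY; have := @valid_At2 (fun _ => X0) u (fun _ => B_X0).
rewrite geval_At => /(_ Y BY hY) [X BX [[y uy Xy] Xatom XY]].
exists y; last exact: XY.
split=> //; exists X => // z uz; split=> [Xz|->//].
apply: contrapT => /B_separates[Z BZ [Zz nZy]].
by case: (Xatom Z BZ) => h; [apply: nZy; apply: h|apply: (h z)].
Qed.

Lemma isolated_reroot u y : isolated u y -> isolated y y.
Proof.
move=> [uy [X BX h]]; split; first exact: near_refl.
by exists X => // z yz; apply: h; apply: (near_trans R_eucl uy).
Qed.

(** In the least proposition containing the image, an isolated world outside the image could be
    removed, against minimality. *)
Lemma isolated_image u X : B X -> exists2 Y, B Y &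
  (forall y z, near u y -> X y -> R y z -> Y z) /\
  forall z, isolated u z -> Y z -> exists y, [/\ near u y, X y & R y z].
Proof.
move=> BX; have := @valid_R2 (fun _ => X0) u (fun _ => B_X0).
rewrite geval_R => /(_ X BX) [Y BY [h1 h2]]; exists Y => //; split=> // z.
move=> [uz [N BN hN]] Yz; apply: contrapT => nz.
have : (~` N) z; last by apply; apply/hN.
apply: (h2 _ (domain_setC BN)) => // y t uy Xy yt /hN tz; apply: nz; exists y; split=> //.
by rewrite -tz //; apply: near_step yt.
Qed.

(** Let [N] isolate [x]. The isolated worlds in the proposition that [isolated_image] gives for [N]
    are successors of [x], and density finds one of them in [Y]. *)
Lemma isolated_succ u x Y : isolated u x -> B Y ->
  (exists2 y, R x y & Y y) -> exists y, [/\ isolated u y, R x y & Y y].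
Proof.
move=> [ux [N BN hN]] BY [y xy Yy]; have [Z BZ [h1 h2]] := isolated_image u BN.
have Nx : N x by apply/hN.
have [|t ht [Yt Zt]] := isolated_dense (u := u) (domain_setI BY BZ).
  exists y; first exact: near_step xy.
  by split=> //; apply: h1 xy.
exists t; split=> //; have [z [uz Nz zt]] := h2 t ht Zt.
by rewrite -(proj1 (hN z uz) Nz).
Qed.

(** * The Kripke frame of isolated worlds *)

Section Points.
Variable u : T.
Hypothesis u_isolated : isolated u u.

(** [classic] supplies the [eqType] structure that the counting game asks for. *)
Definition point : Type := {classic {y | isolated u y}}.
Definition pt (x : point) : T := sval (x : {y | isolated u y}).
Definition trace (X : set T) : set point := [set x | X (pt x)].
Definition traces : set (set point) := [set Y | exists2 X, B X & Y = trace X].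
Definition pointR (x y : point) : Prop := R (pt x) (pt y).
Definition root : point := exist _ u u_isolated.

Lemma pt_isolated x : isolated u (pt x). Proof. exact: (svalP (x : {y | _})). Qed.

Lemma pt_inj x y : pt x = pt y -> x = y.
Proof. by case: x y => [x hx] [y hy] /= xy; apply: eq_exist. Qed.

Lemma traces_setC X : traces X -> traces (~` X).
Proof. by move=> [Y BY ->]; exists (~` Y) => //; apply: domain_setC. Qed.

Lemma traces_setU X Y : traces X -> traces Y -> traces (X `|` Y).
Proof. by move=> [X' BX ->] [Y' BY ->]; exists (X' `|` Y') => //; apply: domain_setU. Qed.

Lemma traces_set1 x : traces [set x].
Proof.
have [ux [X BX h]] := pt_isolated x; exists X => //.
apply/seteqP; split=> y /=; first by move=> ->; apply/h.
by move=> Xy; apply: pt_inj; apply/h => //; have [] := pt_isolated y.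
Qed.

Lemma traces_image X : B X ->
  traces [set y | exists z, [/\ near u z, X z & R z (pt y)]].
Proof.
move=> BX; have [Y BY [h1 h2]] := isolated_image u BX; exists Y => //.
apply/seteqP; split=> y /=; first by move=> [z [uz Xz zy]]; apply: h1 zy.
exact/h2/pt_isolated.
Qed.

Lemma traces_R_root : traces [set y | R u (pt y)].
Proof.
have [_ [X BX h]] := u_isolated.
rewrite (_ : [set _ | _] = [set y | exists z, [/\ near u z, X z & R z (pt y)]]).
  exact: traces_image.
apply/seteqP; split=> y /=; last by move=> [z [uz /h ->]].
by move=> uy; exists u; split; [exact: near_refl|apply/h; first exact: near_refl|].
Qed.

Lemma traces_cluster : traces [set y | cluster R u (pt y)].
Proof.
rewrite (_ : [set _ | _] = [set y | exists z, [/\ near u z, setT z & R z (pt y)]]).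
  exact/traces_image/domain_setT.
apply/seteqP; split=> y /=; first by move=> [z uz zy]; exists z; split=> //; apply: Or32.
by move=> [z [uz _ zy]]; apply: near_succ_cluster zy.
Qed.

Definition zone (y : point) : bool * bool * bool :=
  (y == root, `[< R u (pt y) >], `[< cluster R u (pt y) >]).

(** The root sees its own successors, and every other point sees exactly the cluster. *)
Lemma pointR_zone x y x' y' :
  zone x = zone x' -> zone y = zone y' -> pointR x y -> pointR x' y'.
Proof.
have E s t : pointR s t <-> if (zone s).1.1 then (zone t).1.2 else (zone t).2.
  rewrite /zone /=; case: eqP => [->|sr].
    by split=> [h|/asboolP]; [apply/asboolP|].
  have [us _] := pt_isolated s.
  have su : pt s <> u by move=> h; apply: sr; apply: pt_inj.
  split=> [st|/asboolP]; first by apply/asboolP; apply: (near_succ_cluster R_eucl us st).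
  by apply: (cluster_R R_eucl) => //; apply: (cluster_near R_eucl).
by move=> h h' /E; rewrite h h' => /E.
Qed.

Lemma traces_zone k : traces [set y | zone y = k].
Proof.
have tI := field_setI traces_setC traces_setU.
case: k => [[b1 b2] b3].
rewrite (_ : [set _ | _] = [set y | `[< [set root] y >] = b1] `&`
  [set y | `[< [set y | R u (pt y)] y >] = b2] `&`
  [set y | `[< [set y | cluster R u (pt y)] y >] = b3]).
  apply: (tI _ _ (tI _ _ _ _)); apply: (field_asbool traces_setC).
  - exact: traces_set1.
  - exact: traces_R_root.
  - exact: traces_cluster.
have e y : `[< [set root] y >] = (y == root) by apply/asboolP/eqP.
apply/seteqP; split=> y /=; rewrite e; first by case=> <- <- <-.
by case=> -[<- <-] <-.
Qed.

(** Diamonds keep their witnesses by [isolated_succ]; an arbitrary set witnessing a quantifier is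
    replaced by a trace through [approximate]. *)
Lemma geval_points v a x : (forall p, B (v p)) ->
  geval R B v a (pt x) <-> geval pointR setT (fun p => trace (v p)) a x.
Proof.
elim: a v x => [p|b IH|b IHb c IHc|b IH|p b IH] v x Bv //=.
- by rewrite IH.
- by rewrite IHb // IHc.
- split=> [/(isolated_succ (pt_isolated x) (B_geval b Bv))[y [uy xy h]]|[y xy h]].
    by exists (exist _ y uy : point) => //; apply/IH.
  by exists (pt y) => //; apply/IH.
have Bv' X : B X -> forall q, B ([eta v with p |-> X] q).
  by move=> BX q /=; case: eqP.
have e X : (fun q => trace ([eta v with p |-> X] q)) =
    [eta (fun q => trace (v q)) with p |-> trace X].
  by apply/funext => q /=; case: eqP.
split=> [[X BX /(IH _ _ (Bv' X BX))]|[D _]].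
  by rewrite e; exists (trace X).
(* A bound on the variables of [b], so that finitely many colours suffice. *)
have um : {in used_vars b, forall q, q < (\max_(q <- used_vars b) q).+1}.
  by move=> q qb; rewrite ltnS; apply: leq_bigmax_seq.
case/(approximate pointR_zone traces_setC traces_setU traces_set1 traces_zone _ um).
  by move=> q; exists (v q).
by move=> _ [X BX ->]; rewrite -e => h; exists X => //; apply/IH => //; apply: Bv'.
Qed.

End Points.

(** The extension of [a] is a proposition, so by density [a] holds at an isolated world, which
    serves as the root. *)
Lemma Kripke_counterpart v a x : (forall p, B (v p)) -> geval R B v a x ->
  exists F : frame, valid F ax5 /\ exists v' y, @eval F v' a y.
Proof.
move=> Bv vx.
have [|u /isolated_reroot hu vu] := @isolated_dense x _ (B_geval a Bv).
  by exists x => //; apply: near_refl.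
exists (Frame (@pointR u) (inhabits (root hu))); split.
  by apply/valid_ax5 => s t r; apply: R_eucl.
exists (fun p => trace (v p)), (root hu); rewrite eval_geval.
exact/geval_points.
Qed.

End GeneralToKripke.

(** * Completeness *)

Section Completeness.
Variables (L : set form) (hL : npqml L).
Hypothesis L_axioms : forall s b,
  ([set ax5] `|` axBc `|` [set axAt 2] `|` [set axR 2]) b -> L (subst s b).

Lemma L_axiom b :
  ([set ax5] `|` axBc `|` [set axAt 2] `|` [set axR 2]) b -> L b.
Proof. by move/(L_axioms Var); rewrite subst_id. Qed.

Lemma L_Bc : axBc `<=` L.
Proof. by move=> b hb; apply: L_axiom; left; left; right. Qed.

Definition cworld := {w : set form | is_world L w}.
Definition cacc (w u : cworld) := forall a, sval u a -> sval w (Dia a).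
Definition ext a : set cworld := [set w | sval w a].
Definition exts : set (set cworld) := [set X | exists a, X = ext a].

Lemma cworldP (w : cworld) : is_world L (sval w). Proof. exact: svalP. Qed.

(** A valuation by extensions is a substitution [s]; it must vary in the induction, since a
    quantifier changes it at [p]. Diamonds use [possible_world]. *)
Lemma truth s a : geval cacc exts (fun p => ext (s p)) a = ext (subst s a).
Proof.
elim: a s => [p|b IH|b IHb c IHc|b IH|p b IH] s.
- by [].
- by apply/seteqP; split=> w /=; rewrite IH; move: (world_Neg (cworldP w) (subst s b)) => -[].
- by apply/seteqP; split=> w /=; rewrite IHb IHc => /(world_Or hL _ _ (cworldP w)).
- apply/seteqP; split=> w /=; rewrite IH; first by move=> [u wu ub]; apply: wu.
  case/(possible_world hL L_Bc (cworldP w)) => u [hu ub wu].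
  by exists (exist _ u hu).
set q := bound_var s p b; set b' := subst [eta s with p |-> Var q] b.
have e c : interderivable L (subst1 q c b') (subst [eta s with p |-> c] b).
  have := subst_comp hL [eta Var with q |-> c] [eta s with p |-> Var q] b.
  congr (interderivable _ _ _); apply: eq_subst => r rb /=.
  case: eqVneq => rp /=; first by rewrite eqxx.
  exact/subst1_id/bound_var_notin.
have {}IH c : geval cacc exts [eta (fun r => ext (s r)) with p |-> ext c] b =
    ext (subst [eta s with p |-> c] b).
  by rewrite -IH; congr geval; apply/funext => r /=; case: eqP.
apply/seteqP; split=> w; rewrite geval_Ex.
  case=> _ [c ->]; rewrite IH => h; apply/(world_Ex hL _ _ (cworldP w)).
  by exists c; apply: (world_Imp (cworldP w) (proj2 (e c)) h).
case/(world_Ex hL _ _ (cworldP w)) => c h; exists (ext c); first by exists c.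
by rewrite IH; apply: (world_Imp (cworldP w) (proj1 (e c)) h).
Qed.

Lemma truth_Var a : geval cacc exts (fun p => ext (Var p)) a = ext a.
Proof. by rewrite truth subst_id. Qed.

Lemma cacc_eucl : euclidean cacc.
Proof.
move=> w u t wu wt a ta; have hu := cworldP u; have hw := cworldP w.
apply: contrapT => /(world_Neg hu) una.
have L5 : L (Imp (Dia a) (Box (Dia a))).
  by apply: (L_axioms (fun _ => a) (b := ax5)); left; left; left.
have := world_Imp hw L5 (wt a ta).
by move/(world_Neg hw); apply; apply: wu.
Qed.

Lemma exts_choice (v : nat -> set cworld) : (forall p, exts (v p)) ->
  exists s, v = fun p => ext (s p).
Proof. by case/choice => s h; exists s; apply/funext. Qed.

Lemma completeness : logic_5pi `<=` L.
Proof.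
move=> a a5; apply: contrapT => nLa.
have [|w hw wna] := @consistent_world L hL (Neg a).
  move=> h; apply: nLa; apply: (taut1 hL h); truth_table.
have B_geval v b : (forall p, exts (v p)) -> exts (geval cacc exts v b).
  by move/exts_choice=> [s ->]; exists (subst s b); apply: truth.
have B_sep x y : x <> y -> exists2 X, exts X & X x /\ ~ X y.
  case: x y => [x hx] [y hy] xy; apply: contrapT => h; apply: xy; apply: eq_exist.
  have sub (b : form) : x b -> y b.
    by move=> xb; apply: contrapT => yb; apply: h; exists (ext b); [exists b|].
  apply/seteqP; split=> // b yb; apply: contrapT => /(world_Neg hx) /sub.
  by move/(world_Neg hy).
(* For closed theorems every valuation agrees with the canonical one. *)
have B_thm b : L b -> forall v x, (forall p, exts (v p)) -> free_vars b = [::] ->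
    geval cacc exts v b x.
  move=> Lb v x _ fb; rewrite (@eq_geval _ _ _ _ (fun p => ext (Var p))); last by rewrite fb.
  by rewrite truth_Var; apply: (world_thm (cworldP x)).
have At2 v x : (forall p, exts (v p)) -> geval cacc exts v (axAt 2) x.
  by move=> Bv; apply: B_thm => //; apply: L_axiom; left; right.
have R2 v x : (forall p, exts (v p)) -> geval cacc exts v (axR 2) x.
  by move=> Bv; apply: B_thm => //; apply: L_axiom; right.
have ext_p p : exts (ext (Var p)) by exists (Var p).
have := Kripke_counterpart (a := Neg a) (x := exist _ w hw)
  cacc_eucl B_geval B_sep At2 R2 (ext_p 0) ext_p.
rewrite truth_Var => /(_ wna) [F [F5 [v [y []]]]].
exact: (proj1 (valid_at F a) (a5 F F5) v y).
Qed.

End Completeness.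

Theorem mainTheorem4 :
  logic_5pi = K_Pi ([set ax5] `|` axBc `|` [set axAt 2] `|` [set axR 2]).
Proof.
apply/seteqP; split=> [a a5 L hL L_axioms|]; last exact: soundness.
exact: completeness a5.
Qed.
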